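(* Let $p$ be a prime with $p\equiv 3\pmod 4$ and let $s$ be an integer with $1\le s<p$. Then for all integers $\alpha\ge 0$ and $n\ge 0$, $$\overline{pp}\bigl(3p^{2\alpha+1}(pn+s)\bigr)\equiv 0\pmod 3.$$ In particular (the case $p=3$), for all integers $\alpha\ge 1$ and $n\ge 0$, $$\overline{pp}(9^\alpha(3n+1))\equiv 0\pmod 3\quad\text{and}\quad \overline{pp}(9^\alpha(3n+2))\equiv 0\pmod 3.$$
   Context: For $|q|<1$, $(a;q)_\infty=\prod_{k=1}^\infty(1-aq^{k-1})$. An overpartition of $n$ is a partition of $n$ in which the first occurrence of each number may be overlined; there is exactly one overpartition of $0$ (the empty one). An overpartition pair of $n$ is an ordered pair $(\lambda,\mu)$ of overpartitions such that the sum of all parts of $\lambda$ and $\mu$ is $n$ (either may be the overpartition of $0$). $\overline{pp}(n)$ denotes the number of overpartition pairs of $n$; its generating function is $\sum_{n\ge 0}\overline{pp}(n)q^n=(-q;q)_\infty^2/(q;q)_\infty^2$. *)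

(* Defs.v *)
From mathcomp Require Import all_boot.

Set Implicit Arguments.
Unset Strict Implicit.
Unset Printing Implicit Defensive.

(* A part is a pair (size, overlined?).  An overpartition is the nonincreasing
   sequence of its parts, all of positive size; only the first occurrence of a
   size may be overlined, i.e. an overlined part differs in size from every
   part before it. *)
Definition part := (nat * bool)%type.

Definition is_overpartition (l : seq part) : bool :=
  [&& all (fun x => 0 < x.1) l,
      pairwise (fun x y => y.1 <= x.1) l &
      pairwise (fun x y => y.2 ==> (x.1 != y.1)) l].

Definition weight (l : seq part) : nat := \sum_(x <- l) x.1.

Definition is_overpartition_pair (n : nat) (lm : seq part * seq part) : bool :=
  [&& is_overpartition lm.1, is_overpartition lm.2
    & weight lm.1 + weight lm.2 == n].

(* In a pair of weight n, each overpartition has at most n parts, each of size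
   at most n; bounded sequences over 'I_n.+1 * bool form a finite type in which
   all such pairs can be counted (see pp_enum). *)
Definition bparts (n : nat) := {bseq n of ('I_n.+1 * bool)%type}.

Definition parts_of (n : nat) (l : bparts n) : seq part :=
  [seq (nat_of_ord x.1, x.2) | x <- l].

Definition pp (n : nat) : nat :=
  #|[set lm : bparts n * bparts n
      | is_overpartition_pair n (parts_of lm.1, parts_of lm.2)]|.

Lemma parts_of_inj (n : nat) : injective (@parts_of n).
Proof.
move=> l l' eq_ll'; apply: val_inj.
by apply: inj_map eq_ll' => -[i b] [j c] [/val_inj -> ->].
Qed.

Lemma parts_of_bounded (n : nat) (l : seq part) :
  is_overpartition l -> weight l <= n -> exists l' : bparts n, parts_of l' = l.
Proof.
case/and3P=> pos_l _ _ le_ln.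
have bnd_l : all (fun x => x.1 <= n) l.
  apply/allP=> x xl; apply: leq_trans le_ln.
  by rewrite /weight (big_rem x xl) /= leq_addr.
have sz_l : size l <= n.
  apply: leq_trans le_ln; rewrite /weight; elim: l pos_l {bnd_l} => //= x l IH.
  by case/andP=> x0 /IH le; rewrite big_cons -add1n leq_add.
have sz : size [seq (inord x.1 : 'I_n.+1, x.2) | x <- l] <= n by rewrite size_map.
exists (Bseq sz); rewrite /parts_of /= -map_comp -[RHS]map_id.
apply/eq_in_map=> -[k b] /(allP bnd_l) /= le_kn.
by rewrite inordK.
Qed.

Lemma pp_enum (n : nat) (e : seq (seq part * seq part)) :
  uniq e -> (forall lm, (lm \in e) = is_overpartition_pair n lm) ->
  size e = pp n.
Proof.
move=> uniq_e mem_e.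
pose f (lm : bparts n * bparts n) := (parts_of lm.1, parts_of lm.2).
have f_inj : injective f.
  by move=> [a b] [c d] [/parts_of_inj -> /parts_of_inj ->].
rewrite /pp cardE -(size_map f).
apply/perm_size/uniq_perm => //; first by rewrite map_inj_uniq ?enum_uniq.
move=> -[l m]; rewrite mem_e; apply/idP/mapP => [lm_n | [x]]; last first.
  by rewrite mem_enum inE => ? ->.
have /and3P[ol om /eqP wlm] := lm_n.
have [|l' El] := parts_of_bounded (n := n) ol; first by rewrite -wlm leq_addr.
have [|m' Em] := parts_of_bounded (n := n) om; first by rewrite -wlm leq_addl.
by exists (l', m'); rewrite ?mem_enum ?inE /f /= El Em.
Qed.

(* Main.v *)
Require Import Defs.
From mathcomp Require Import all_boot all_algebra ring.

(** Counting overpartitions by largest part gives the series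
    prod_i (1 + q^i) / (1 - q^i), and Gauss's identity says that its inverse is
    the theta series T(q) = sum_(j in Z) (-1)^j q^(j^2); so the generating
    function of pp is 1 / T^2.  Modulo 3, T^3 = T(q^3), hence
    1 / T^2 = T / T^3 = T(q) / T(q^3).  Squares are 0 or 1 modulo 3, and the
    terms of T whose exponent is a multiple of 3 are those with 3 | j; they
    form T(q^9) = T^9.  Keeping the exponents divisible by 3 in T(q) / T(q^3)
    therefore leaves T^9 / T^3 = T(q)^6 = (T^2)(q^3), that is

      pp(3 n) = [q^n] T(q)^2   modulo 3          (lemma pp_mul3),

    which vanishes unless n is a sum of two squares (pp_mul3_dvd).  If
    p = 3 mod 4 is prime then -1 is not a square modulo p, so p divides a sum
    of two squares to an even power only (sum_squares_valuation), whereas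
    p^(2 alpha + 1) (p n + s) has odd p-adic valuation.

    Formal power series are handled as polynomials modulo 'X^N (eqmodX), and
    Gauss's identity is proved in a finite form in the manner of Shanks
    (shanks_identity), by a telescoping sum.  The counts are related to these products by
    an explicit recursive enumeration of overpartitions (overp_enum). *)

Set Implicit Arguments.
Unset Strict Implicit.
Unset Printing Implicit Defensive.
Import GRing.Theory.

(** * A finite form of Gauss's theta identity *)

Section Shanks.
Local Open Scope ring_scope.
Variables (R : comNzRingType) (x : R).

(** The partial sum of the [(-1) ^ j * x ^ (j ^ 2)] over all integers [j] with
    [`|j| <= n]; pairing [j] with [- j] gives the factor 2. *)
Definition theta (n : nat) : R :=
  1 + \sum_(j < n) (-1) ^+ j.+1 * x ^+ (j.+1 ^ 2) *+ 2.

Lemma thetaS n :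
  theta n.+1 = theta n + (-1) ^+ n.+1 * x ^+ (n.+1 ^ 2) *+ 2.
Proof. by rewrite /theta big_ord_recr /= addrA. Qed.

Definition shanks_term (n s : nat) : R :=
  (-1) ^+ s.+1 * (\prod_(s.+1 <= i < n) (1 - x ^+ i.+1)) *
  (\prod_(0 <= i < s) (1 + x ^+ i.+1)) * x ^+ (s.+1 * n.+1).

(** Every correction term is divisible by [x ^ n.+1], so that as [n] grows the
    identity becomes
    [theta = \prod_i (1 - x ^ i) / (1 + x ^ i)].  Up to the factor
    [1 + x ^ n.+1], increasing [n] changes the [s]-th correction by a
    difference [V s - V s.+1], so that all the changes telescope; the two
    boundary terms provide the new factor of the product and the new term of
    [theta]. *)
Lemma shanks_identity n :
  (\prod_(i < n) (1 + x ^+ i.+1)) * theta n =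
  \prod_(i < n) (1 - x ^+ i.+1) + \sum_(s < n) shanks_term n s *+ 2.
Proof.
elim: n => [|n IH]; first by rewrite /theta !big_ord0 !addr0 mul1r.
pose V s := (-1) ^+ s * (\prod_(s <= i < n) (1 - x ^+ i.+1)) *
     (\prod_(0 <= i < s) (1 + x ^+ i.+1)) * x ^+ (s.+1 * n.+1).
have step s : (s < n)%N ->
    shanks_term n.+1 s = (1 + x ^+ n.+1) * shanks_term n s - (V s.+1 - V s).
  move=> lt_sn; rewrite /V /shanks_term.
  have -> : \prod_(s.+1 <= i < n.+1) (1 - x ^+ i.+1) =
    (\prod_(s.+1 <= i < n) (1 - x ^+ i.+1)) * (1 - x ^+ n.+1).
    by rewrite big_nat_recr.
  have -> : \prod_(0 <= i < s.+1) (1 + x ^+ i.+1) =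
    (\prod_(0 <= i < s) (1 + x ^+ i.+1)) * (1 + x ^+ s.+1).
    by rewrite big_nat_recr.
  rewrite (big_ltn lt_sn).
  set P := \prod_(s.+1 <= i < n) _; set Q := \prod_(0 <= i < s) _.
  rewrite (mulnS s.+1 n.+1) (mulSn s.+1 n.+1) !exprD !exprS.
  by ring.
have sumE : \sum_(s < n) shanks_term n.+1 s *+ 2 =
    (1 + x ^+ n.+1) * (\sum_(s < n) shanks_term n s *+ 2) - (V n - V 0) *+ 2.
  rewrite -(telescope_sumr V (leq0n n)) big_mkord mulr_sumr -sumrMnl -sumrB.
  by apply: eq_bigr => s _; rewrite step //; ring.
have lastE : shanks_term n.+1 n =
    (-1) ^+ n.+1 * (\prod_(i < n) (1 + x ^+ i.+1)) * x ^+ (n.+1 ^ 2) * x ^+ n.+1.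
  rewrite /shanks_term big_geq // mulr1 big_mkord -!mulrA -exprD.
  by rewrite -mulnn mulnS addnC.
have V0 : V 0%N = (\prod_(i < n) (1 - x ^+ i.+1)) * x ^+ n.+1.
  by rewrite /V expr0 mul1r big_mkord [X in _ * X * _]big_geq // mulr1 mul1n.
have Vn : V n = (-1) ^+ n * (\prod_(i < n) (1 + x ^+ i.+1)) * x ^+ (n.+1 ^ 2).
  by rewrite /V big_mkord [X in _ * X * _ * _]big_geq // mulr1 mulnn.
rewrite [X in _ = _ + X]big_ord_recr /= sumE lastE V0 Vn.
rewrite big_ord_recr /= [X in _ = X + _]big_ord_recr /=.
rewrite thetaS mulrDr [_ * (1 + _) * theta n]mulrAC IH [(-1) ^+ n.+1]exprS.
set P := \prod_(i < n) _; set Q := \prod_(i < n) _.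
set y := x ^+ n.+1; set z := x ^+ _.
by ring.
Qed.

End Shanks.

(** * Enumeration of overpartitions by largest part *)

Definition overp (m n : nat) (l : seq part) : bool :=
  [&& is_overpartition l, all (fun x => x.1 <= m) l & weight l == n].

(** Once an [m] has been put in front of a nonincreasing sequence, overlined or
    not, the part [m] may no longer be overlined in what follows.  Hence this
    second class, which makes the decomposition by first part recursive. *)
Definition overp_plain (m n : nat) (l : seq part) : bool :=
  overp m n l && ((m, true) \notin l).

Lemma overp0 n l : overp 0 n l = (l == [::]) && (n == 0).
Proof.
rewrite /overp /weight; case: l => [|[k b] l]; first by rewrite big_nil eq_sym.
by rewrite /is_overpartition /= leqn0 lt0n; case: (k == 0); rewrite ?andbF.
Qed.

Lemma overp_nil m n : overp m n [::] = (n == 0).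
Proof. by rewrite /overp /weight big_nil eq_sym. Qed.

Lemma overp_cons_max m n b l :
  overp m.+1 n ((m.+1, b) :: l) = (m < n) && overp_plain m.+1 (n - m.+1) l.
Proof.
rewrite /overp_plain /overp /is_overpartition /weight /= big_cons leqnn /=.
have -> : (m.+1 + \sum_(j <- l) j.1 == n) =
          (m < n) && (\sum_(j <- l) j.1 == n - m.+1).
  case: (ltnP m n) => /= h; first by rewrite -{1}(subnKC h) eqn_add2l.
  by apply/negbTE; rewrite neq_ltn; apply/orP; right; apply: leq_trans (leq_addr _ _).
have -> : ((m.+1, true) \notin l) = all (fun y => y.2 ==> (m.+1 != y.1)) l.
  elim: l => //= -[k c] l <-; rewrite inE negb_or xpair_eqE; congr (_ && _).
  by case: c => /=; rewrite ?andbT ?andbF.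
by case: (all (fun x => x.1 <= m.+1) l); rewrite ?andbF ?andbT //=;
  case: (m < n); rewrite ?andbF //=; case: (all _ l); rewrite ?andbF ?andbT //=;
  case: (all _ l); rewrite ?andbF ?andbT.
Qed.

Lemma overp_cons_lt m n k b l : k != m.+1 ->
  overp m.+1 n ((k, b) :: l) = overp m n ((k, b) :: l).
Proof.
move=> km; rewrite /overp /=.
have -> : (k <= m.+1) = (k <= m) by rewrite leq_eqVlt (negbTE km).
case: (boolP (is_overpartition _)) => //= /and3P[_ /= /andP[/allP kl _] _].
case: (leqP k m) => //= le_km; congr (_ && _).
by apply/allP/allP => h x xl; apply: leq_trans (kl x xl) _ => //; apply: ltnW.
Qed.

Lemma overp_plain_cons_lt m n k b l : k != m.+1 ->
  overp_plain m.+1 n ((k, b) :: l) = overp m n ((k, b) :: l).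
Proof.
move=> km; rewrite /overp_plain overp_cons_lt //; case: (boolP (overp _ _ _)) => //=.
case/and3P=> _ /allP h _; apply/negP => /h /=.
by rewrite ltnn.
Qed.

(** Given an enumeration [prev] of the overpartitions with parts at most [m],
    enumerates those with parts at most [m.+1] and no overlined [m.+1]: a
    sequence without part [m.+1], or an [m.+1] followed by a shorter sequence of
    the same kind.  The weight [n] is enough fuel, since each step decreases
    it. *)
Fixpoint plain_enum (m : nat) (prev : nat -> seq (seq part)) (fuel n : nat) :=
  prev n ++
  if fuel isn't k.+1 then [::] else
  if m < n then [seq (m.+1, false) :: l | l <- plain_enum m prev k (n - m.+1)]
  else [::].

Fixpoint overp_enum (m n : nat) : seq (seq part) :=
  if m isn't k.+1 then if n == 0 then [:: [::]] else [::] else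
  plain_enum k (overp_enum k) n n ++
  if k < n then
    [seq (k.+1, true) :: l | l <- plain_enum k (overp_enum k) (n - k.+1) (n - k.+1)]
  else [::].

Section PlainEnum.
Variables (m : nat) (prev : nat -> seq (seq part)).

Lemma plain_enum_fuel k k' n : n <= k -> n <= k' ->
  plain_enum m prev k n = plain_enum m prev k' n.
Proof.
elim: k k' n => [|k IH] [|k'] n //= nk nk'.
- by case: n nk {nk'}.
- by case: n nk' {nk}.
congr (_ ++ _); case: ltnP => // mn.
have le_sub j : n <= j.+1 -> n - m.+1 <= j.
  by move=> nj; rewrite leq_subLR addSn; apply: leq_trans nj _; rewrite ltnS leq_addl.
by rewrite (IH k') // le_sub.
Qed.

Lemma plain_enumE n : plain_enum m prev n n = prev n ++
  if m < n then [seq (m.+1, false) :: l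
                | l <- plain_enum m prev (n - m.+1) (n - m.+1)] else [::].
Proof.
case: n => //= n; congr (_ ++ _); case: ifP => // mn.
by rewrite (@plain_enum_fuel n (n.+1 - m.+1)) // subSS leq_subr.
Qed.

Hypothesis prevP : forall n, uniq (prev n) /\ forall l, (l \in prev n) = overp m n l.

Lemma plain_enumP n : uniq (plain_enum m prev n n) /\
  forall l, (l \in plain_enum m prev n n) = overp_plain m.+1 n l.
Proof.
elim/ltn_ind: n => n IH; rewrite plain_enumE; have [Up Mp] := prevP n.
have lt_sub : m < n -> n - m.+1 < n.
  by move=> mn; rewrite ltn_subrL /= (leq_ltn_trans _ mn).
split.
  rewrite cat_uniq Up /=; case: ifP => //= mn; have [Ui _] := IH _ (lt_sub mn).
  rewrite map_inj_uniq ?Ui ?andbT; last by move=> ? ? [].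
  apply/hasPn => _ /mapP[l _ ->]; rewrite Mp /overp /=.
  by rewrite ltnn !andbF.
case=> [|[k b] l]; rewrite mem_cat Mp.
  rewrite overp_nil /overp_plain overp_nil andbT orbC.
  by case: ifP => // _; case: mapP => // -[].
have [-> | km] := eqVneq k m.+1; last first.
  rewrite overp_plain_cons_lt // orbC; case: ifP => // _.
  case: mapP => // -[l' _ [E]]; by rewrite E eqxx in km.
rewrite /overp_plain overp_cons_max inE negb_or xpair_eqE eqxx /=.
have -> : overp m n ((m.+1, b) :: l) = false by rewrite /overp /= ltnn !andbF.
case: ifP => //= mn; have [_ Mi] := IH _ (lt_sub mn).
case: b => /=; first by rewrite andbF; apply/mapP => -[].
rewrite mem_map ?Mi; last by move=> ? ? [].
by rewrite /overp_plain -andbA andbb.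
Qed.
End PlainEnum.

Lemma overp_enumP m n :
  uniq (overp_enum m n) /\ forall l, (l \in overp_enum m n) = overp m n l.
Proof.
elim: m n => [|m IH] n /=.
  by split=> [|l]; rewrite ?overp0; case: (n == 0) => //;
    rewrite ?in_nil ?inE ?andbT ?andbF.
have [Up Mp] := plain_enumP IH n; have [Us Ms] := plain_enumP IH (n - m.+1).
split.
  rewrite cat_uniq Up /=; case: ifP => //= mn.
  rewrite map_inj_uniq ?Us ?andbT; last by move=> ? ? [].
  by apply/hasPn => _ /mapP[l _ ->]; rewrite Mp /overp_plain inE eqxx andbF.
case=> [|[k b] l]; rewrite mem_cat Mp.
  by rewrite /overp_plain overp_nil andbT orbC; case: ifP => // _; case: mapP => // -[].
have [-> | km] := eqVneq k m.+1; last first.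
  rewrite overp_plain_cons_lt // overp_cons_lt // orbC; case: ifP => // _.
  by case: mapP => // -[l' _ [E]]; rewrite E eqxx in km.
rewrite /overp_plain !overp_cons_max inE xpair_eqE eqxx /=.
case: ifP => //= mn; case: b => /=.
  rewrite andbF /= mem_map ?Ms //; by move=> ? ? [].
rewrite [X in _ || X](_ : _ = false) ?orbF; last by apply/mapP => -[].
by rewrite /overp_plain -andbA andbb.
Qed.

(** A single bound [N] on the parts serves all weights [n <= N], so that one
    polynomial of size [N.+1] can hold all these counts. *)
Lemma overp_enum_pp N n : n <= N ->
  pp n = \sum_(i < n.+1) size (overp_enum N i) * size (overp_enum N (n - i)).
Proof.
move=> nN; pose e := [seq z | i <- iota 0 n.+1,
   z <- [seq (l, l') | l <- overp_enum N i, l' <- overp_enum N (n - i)]].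
have overp_weight m i l : overp m i l -> weight l = i by case/and3P=> _ _ /eqP.
have overp_ov l : is_overpartition l -> weight l <= N -> overp N (weight l) l.
  move=> ol wl; rewrite /overp ol eqxx andbT; apply/allP => x xl.
  by apply: leq_trans wl; rewrite /weight (big_rem x xl) /= leq_addr.
rewrite -(@pp_enum n e).
- rewrite /e size_allpairs_dep sumnE big_map.
  rewrite -(big_mkord xpredT
    (fun i => size (overp_enum N i) * size (overp_enum N (n - i)))).
  rewrite /index_iota subn0.
  by apply: eq_bigr => i _; rewrite size_allpairs.
- rewrite /e allpairs_uniq_dep ?iota_uniq //.
    move=> i _; apply: allpairs_uniq; try exact: (overp_enumP _ _).1.
    by case=> ? ? [? ?] _ _ /= [-> ->].
  (* A pair determines the block in which it is listed: the index of the block is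
     the weight of its first component. *)
  have tagE (p : {_ : nat & (seq part * seq part)%type}) :
      p \in [seq @Tagged nat i (fun=> (seq part * seq part)%type) z
      | i <- iota 0 n.+1,
        z <- [seq (l, l') | l <- overp_enum N i, l' <- overp_enum N (n - i)]] ->
      tag p = weight (tagged p).1.
    case/allpairsPdep=> i [z [_ /allpairsP[[a b] /= [ai _ ->]] ->]] /=.
    by move: ai; rewrite (overp_enumP _ _).2 => /overp_weight ->.
  by move=> [i z] [j z'] /tagE /= -> /tagE /= -> /= ->.
case=> l l'; apply/idP/idP.
  case/allpairsPdep=> i [z [+ /allpairsP[[a b] /= [ai bi ->]] [-> ->]]].
  rewrite mem_iota /= add0n ltnS => le_in.
  move: ai bi; rewrite !(overp_enumP _ _).2 => ai bi.
  rewrite /is_overpartition_pair /= (overp_weight _ _ _ ai) (overp_weight _ _ _ bi).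
  by rewrite subnKC // eqxx; case/and3P: ai => ->; case/and3P: bi => ->.
case/and3P=> /= ol ol' /eqP w; apply/allpairsPdep; exists (weight l), (l, l').
split=> //; first by rewrite mem_iota /= add0n ltnS -w leq_addr.
apply/allpairsP; exists (l, l'); split=> //=; rewrite (overp_enumP _ _).2.
  by apply: overp_ov => //; apply: leq_trans nN; rewrite -w leq_addr.
by rewrite -w addKn; apply: overp_ov => //; apply: leq_trans nN; rewrite -w leq_addl.
Qed.

(** * Power series modulo a power of the variable *)

Section TruncatedSeries.
Local Open Scope ring_scope.
Variable F : fieldType.
Implicit Types p q r : {poly F}.

Definition eqmodX (N : nat) p q := 'X^N %| p - q.

Lemma eqmodXP N p q :
  reflect (forall i, (i < N)%N -> p`_i = q`_i) (eqmodX N p q).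
Proof.
apply: (iffP idP) => [/dvdpP[r E] i iN | h].
  by apply/eqP; rewrite -subr_eq0 -coefB E coefMXn iN.
apply/dvdpP; exists (drop_poly N (p - q)).
rewrite -[LHS](poly_take_drop N) [X in X + _](_ : _ = 0) ?add0r //.
apply/polyP => i; rewrite coef_take_poly coef0 coefB.
by case: ifP => // /h ->; rewrite subrr.
Qed.

Lemma eqmodX_refl N p : eqmodX N p p.
Proof. by rewrite /eqmodX subrr dvdp0. Qed.

Lemma eqmodX_sym N p q : eqmodX N p q -> eqmodX N q p.
Proof. by rewrite /eqmodX -[q - p]opprB dvdpNr. Qed.

Lemma eqmodX_trans N q p r : eqmodX N p q -> eqmodX N q r -> eqmodX N p r.
Proof.
move=> pq qr; have Epr : p - r = (p - q) + (q - r) by ring.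
by rewrite /eqmodX Epr dvdp_add.
Qed.

Lemma eqmodX_mul N p q p' q' :
  eqmodX N p p' -> eqmodX N q q' -> eqmodX N (p * q) (p' * q').
Proof.
rewrite /eqmodX => hp hq.
have -> : p * q - p' * q' = p * (q - q') + (p - p') * q' by ring.
by apply: dvdp_add; [apply: dvdp_mull | apply: dvdp_mulr].
Qed.

Lemma eqmodX_leq M N p q : (M <= N)%N -> eqmodX N p q -> eqmodX M p q.
Proof. by move=> MN; apply: dvdp_trans; apply: dvdp_exp2l. Qed.

Lemma eqmodX_cancel N r p q : r.[0] != 0 ->
  eqmodX N (p * r) (q * r) -> eqmodX N p q.
Proof.
move=> r0; rewrite /eqmodX -mulrBl Gauss_dvdpl // coprimep_sym.
by rewrite coprimep_expr // coprimepX.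
Qed.

(** * The generating function of overpartitions is the inverse of theta *)

Lemma theta_stable n m : (n <= m)%N ->
  eqmodX n.+1 (theta 'X m : {poly F}) (theta 'X n).
Proof.
elim: m => [|m IH]; first by rewrite leqn0 => /eqP ->; apply: eqmodX_refl.
rewrite leq_eqVlt => /predU1P[<- | nm]; first exact: eqmodX_refl.
apply: eqmodX_trans (IH nm); rewrite /eqmodX thetaS addrAC subrr add0r.
rewrite -mulrnAl dvdp_mull // dvdp_exp2l //.
by rewrite -mulnn (leq_trans _ (leq_pmull _ _)).
Qed.

Lemma theta_mod n :
  eqmodX n.+1 ((\prod_(i < n) (1 + 'X^(i.+1))) * theta 'X n)
              (\prod_(i < n) (1 - 'X^(i.+1)) : {poly F}).
Proof.
rewrite /eqmodX shanks_identity addrC addKr.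
apply: (big_ind (fun p => 'X^(n.+1) %| p)) => [|p q|s _]; first exact: dvdp0.
  exact: dvdp_add.
by rewrite -mulrnAl dvdp_mull // dvdp_exp2l // leq_pmull.
Qed.

Definition overp_poly (N m : nat) : {poly F} :=
  \poly_(i < N) (size (overp_enum m i))%:R.

(** Let [H] be the series of the overpartitions with parts at most [m.+1] and no
    overlined [m.+1].  Those with a part [m.+1] are counted by ['X^(m.+1) * H],
    hence the series [H * (1 - 'X^(m.+1))] for the bound [m]; putting one
    overlined [m.+1] in front gives the others for the bound [m.+1], hence the
    series [H * (1 + 'X^(m.+1))]. *)
Lemma overp_polyS N m :
  eqmodX N (overp_poly N m.+1 * (1 - 'X^(m.+1))) (overp_poly N m * (1 + 'X^(m.+1))).
Proof.
pose H : {poly F} := \poly_(i < N) (size (plain_enum m (overp_enum m) i i))%:R.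
have HS : eqmodX N (overp_poly N m.+1) (H * (1 + 'X^(m.+1))).
  apply/eqmodXP => i iN; rewrite mulrDr mulr1 coefD coefMXn !coef_poly iN /=.
  rewrite size_cat natrD ltnS (leq_ltn_trans (leq_subr _ _) iN).
  by case: (ltnP m i) => //= _; rewrite size_map.
have HE : eqmodX N (overp_poly N m) (H * (1 - 'X^(m.+1))).
  apply/eqmodXP => i iN; rewrite mulrBr mulr1 coefB coefMXn !coef_poly iN /=.
  rewrite plain_enumE size_cat natrD ltnS (leq_ltn_trans (leq_subr _ _) iN).
  case: (ltnP m i) => //= _; last by rewrite addr0 subr0.
  by rewrite size_map addrK.
apply: eqmodX_trans (eqmodX_mul HS (eqmodX_refl _ _)) _.
by rewrite mulrAC; apply/eqmodX_sym/eqmodX_mul/eqmodX_refl.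
Qed.

Lemma overp_poly_prod N m : (0 < N)%N ->
  eqmodX N (overp_poly N m * \prod_(i < m) (1 - 'X^(i.+1)))
           (\prod_(i < m) (1 + 'X^(i.+1))).
Proof.
move=> N0; elim: m => [|m IH].
  rewrite !big_ord0 mulr1; apply/eqmodXP => i iN.
  by rewrite coef_poly iN coef1 /=; case: eqP.
rewrite !big_ord_recr /=; set D := \prod_(i < m) _; set E := \prod_(i < m) _.
have step := eqmodX_mul (overp_polyS N m) (eqmodX_refl N D).
have {}IH := eqmodX_mul IH (eqmodX_refl N (1 + 'X^(m.+1))).
by rewrite mulrA mulrAC; apply: eqmodX_trans step _; rewrite mulrAC.
Qed.

Lemma overp_poly_theta N m : (0 < N <= m.+1)%N ->
  eqmodX N (overp_poly N m * theta 'X m) 1.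
Proof.
case/andP=> N0 Nm; apply: (@eqmodX_cancel _ (\prod_(i < m) (1 + 'X^(i.+1)))).
  rewrite horner_prod; apply/prodf_neq0 => i _.
  by rewrite hornerD hornerXn hornerC expr0n addr0 oner_eq0.
rewrite mul1r -mulrA [theta _ _ * _]mulrC.
apply: eqmodX_trans (overp_poly_prod m N0).
apply: eqmodX_mul (eqmodX_refl _ _) _.
exact: eqmodX_leq Nm (theta_mod m).
Qed.

End TruncatedSeries.

(** * Reduction modulo 3 *)

Section Modulo3.
Local Open Scope ring_scope.

Lemma theta_rmorph (R S : comNzRingType) (f : {rmorphism R -> S}) x n :
  f (theta x n) = theta (f x) n.
Proof.
rewrite rmorphD rmorph1 rmorph_sum; congr (_ + _); apply: eq_bigr => j _.
by rewrite rmorphMn rmorphM rmorph_sign rmorphXn.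
Qed.

Lemma cube_poly_F3 (p : {poly 'F_3}) : p ^+ 3 = p \Po 'X^3.
Proof.
have pch : 3%N \in [pchar {poly 'F_3}] by rewrite pchar_poly pchar_Fp.
elim/poly_ind: p => [|p c IH]; first by rewrite comp_poly0 expr0n.
rewrite comp_polyD comp_polyM comp_polyX comp_polyC -IH.
rewrite exprDn_pchar ?pnatE // exprMn -polyC_exp; congr (_ + _%:P).
by case: c => -[|[|[|]]] //= h; apply/val_inj.
Qed.

(** A square is a multiple of 3 only if its root is, and [(3 * j) ^ 2 = 9 * j ^ 2]
    while [(-1) ^ (3 * j) = (-1) ^ j]: the exponents divisible by 3 in [theta]
    are those of [theta] at ['X^9]. *)
Lemma theta_trisect (R : comNzRingType) k i :
  (theta 'X (3 * k) - theta 'X^9 k : {poly R})`_(3 * i) = 0.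
Proof.
elim: k => [|k IH]; first by rewrite /theta !big_ord0 subrr coef0.
have coefT c j : ((-1) ^+ c * 'X^j : {poly R})`_(3 * i) = (-1) ^+ c * ((3 * i)%N == j)%:R.
  by rewrite -polyC1 -polyCN -polyC_exp coefCM coefXn.
have nsq j : (j %% 3 != 0)%N -> ((3 * i)%N == j ^ 2)%N = false.
  move=> j3; apply/eqP => /(congr1 (dvdn 3)); rewrite dvdn_mulr // Euclid_dvdX //= /dvdn.
  by rewrite andbT (negbTE j3).
rewrite mulnSr addn3 !thetaS -exprM.
have -> : (9 * k.+1 ^ 2 = (3 * k).+3 ^ 2)%N.
  by rewrite -[(3 * k).+3]/(3 + 3 * k)%N -mulnS expnMn.
have -> : (-1) ^+ (3 * k).+3 = (-1) ^+ k.+1 :> {poly R}.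
  by rewrite -signr_odd -[RHS]signr_odd /= oddM /= negbK.
rewrite (_ : _ - _ = theta 'X (3 * k) - theta 'X^9 k +
  ((-1) ^+ (3 * k).+1 * 'X^((3 * k).+1 ^ 2) *+ 2 +
   (-1) ^+ (3 * k).+2 * 'X^((3 * k).+2 ^ 2) *+ 2)); last by ring.
have mod1 : ((3 * k).+1 %% 3 = 1)%N by rewrite mulnC -addn1 modnMDl.
have mod2 : ((3 * k).+2 %% 3 = 2)%N by rewrite mulnC -addn2 modnMDl.
rewrite coefD IH add0r coefD !coefMn !coefT !nsq ?mod1 ?mod2 //.
by rewrite !mulr0 !mul0rn addr0.
Qed.

(** If [OP] is inverse to [T] and [T3], two truncations of the same series, then
    [OP ^+ 2 = OP ^+ 3 * T3 = OP ^+ 3 * (T3 - T ^+ 9) + T ^+ 6], and cubes are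
    polynomials in ['X^3].  For [T = theta] the difference [T3 - T ^+ 9] has no
    exponent divisible by 3, so the last summand alone contributes to such
    exponents in [OP ^+ 2]. *)
Lemma overp_poly_sqr_mod3 N (OP T T3 : {poly 'F_3}) :
  eqmodX N (OP * T3) 1 -> eqmodX N T3 T ->
  eqmodX N (OP ^+ 2) ((OP \Po 'X^3) * (T3 - T ^+ 9) + (T ^+ 2 \Po 'X^3)).
Proof.
move=> OPT3 T3T; rewrite -!cube_poly_F3.
have OPT : eqmodX N (OP * T) 1.
  by apply: eqmodX_trans OPT3; apply/eqmodX_mul/eqmodX_sym/T3T/eqmodX_refl.
have h3 : eqmodX N ((OP * T) ^+ 3) 1.
  by have := eqmodX_mul OPT (eqmodX_mul OPT OPT); rewrite !mulr1 -expr2 -exprS.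
rewrite /eqmodX in OPT3 h3 *.
have -> : OP ^+ 2 - (OP ^+ 3 * (T3 - T ^+ 9) + (T ^+ 2) ^+ 3) =
   - (OP ^+ 2 * (OP * T3 - 1)) + T ^+ 6 * ((OP * T) ^+ 3 - 1) by ring.
by rewrite dvdp_add // ?dvdpNr dvdp_mull.
Qed.

Lemma coef_overp_poly_sqr (F : fieldType) N m n : (n < N)%N -> (n <= m)%N ->
  (overp_poly F N m ^+ 2)`_n = (pp n)%:R.
Proof.
move=> nN nm; rewrite expr2 coefM (overp_enum_pp nm) natr_sum.
apply: eq_bigr => i _; rewrite natrM !coef_poly.
by rewrite (leq_ltn_trans (leq_subr _ _) nN) (leq_trans (ltn_ord i) nN).
Qed.

(** The truncation orders [N] and [3 * N] are chosen so that [theta 'X (3 * N)]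
    corresponds exactly to [theta 'X^9 N] in [theta_trisect]. *)
Lemma pp_mul3 N n : (3 * n < N)%N ->
  (pp (3 * n))%:R = (theta 'X N ^+ 2 : {poly 'F_3})`_n.
Proof.
move=> nN; have le_N : (N <= 3 * N)%N by rewrite leq_pmull.
have OPT3 : eqmodX N (overp_poly 'F_3 N (3 * N) * theta 'X (3 * N)) 1.
  by apply: overp_poly_theta; rewrite leqW // (leq_ltn_trans _ nN).
have T3T := eqmodX_leq (leqnSn N) (theta_stable 'F_3 le_N).
have /eqmodXP/(_ _ nN) := overp_poly_sqr_mod3 OPT3 T3T.
rewrite coef_overp_poly_sqr //; last exact: leq_trans (ltnW nN) le_N.
move=> ->; rewrite coefD coef_comp_poly_Xn // dvdn_mulr // mulKn //.
(* In the first product only indices divisible by 3 survive in the factor in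
   ['X^3], and the complementary index in the other factor is then divisible
   by 3 too. *)
rewrite [X in X + _](_ : _ = 0) ?add0r // coefM.
have T9E : (theta 'X N : {poly 'F_3}) ^+ 9 = theta 'X^9 N.
  rewrite (exprM _ 3 3) (cube_poly_F3 (_ ^+ 3)) (cube_poly_F3 (theta _ _)).
  rewrite !(theta_rmorph (comp_poly 'X^3)).
  by rewrite /= comp_polyX comp_Xn_poly -exprM.
apply: big1 => /= j _; rewrite coef_comp_poly_Xn //.
case: ifP => [/dvdnP[j' Ej] | _]; last by rewrite mul0r.
have -> : (3 * n - j = 3 * (n - j'))%N by rewrite mulnBr Ej [(j' * 3)%N]mulnC.
by rewrite T9E theta_trisect mulr0.
Qed.

Lemma theta_coef_square (R : comNzRingType) k i :
  (theta 'X k : {poly R})`_i != 0 -> exists a, i = (a ^ 2)%N.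
Proof.
elim: k => [|k IH].
  rewrite /theta big_ord0 addr0 coef1; case: i => [|i]; last by rewrite eqxx.
  by exists 0%N.
rewrite thetaS coefD coefMn -polyC1 -polyCN -polyC_exp coefCM coefXn.
have [-> _ | _] := eqVneq i (k.+1 ^ 2)%N; first by exists k.+1.
by rewrite mulr0 mul0rn addr0.
Qed.

End Modulo3.

(** * Sums of two squares *)

(** If [p] did not divide [d], then [x = c / d] would satisfy [x ^ 2 = -1] in
    ['F_p], so [x ^ 4 = 1] and, [p] being of the form [4 k + 3], Fermat's
    theorem would give [x = x ^ p = x ^ 3 = - x]. *)
Lemma dvdn_sum_squares p a b : prime p -> p = 3 %[mod 4] ->
  p %| a ^ 2 + b ^ 2 -> (p %| a) && (p %| b).
Proof.
move=> pp p3 dvd; have pch := pchar_Fp pp.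
have p_gt2 : 2 < p by case: p pp p3 {dvd pch} => [|[|[|]]].
have dvd_snd c d : p %| c ^ 2 + d ^ 2 -> p %| d.
  move=> {}dvd; apply/contraT => ndvd.
  have d0 : (d%:R != 0 :> 'F_p)%R by rewrite -(dvdn_pcharf pch).
  pose x : 'F_p := (c%:R / d%:R)%R.
  have x2 : (x ^+ 2 = -1)%R.
    rewrite /x expr_div_n; apply: (mulIf (expf_neq0 2 d0)).
    rewrite mulfVK ?expf_neq0 // mulN1r; apply/eqP; rewrite -subr_eq0 opprK.
    by rewrite -!natrX -natrD -(dvdn_pcharf pch).
  have xp : (x ^+ p = x)%R.
    have /(congr1 (fun k => k%:R : 'F_p)%R) := fermat_little (val x) pp.
    by rewrite !Fp_nat_mod // natrX natr_Zp.
  have pE : p = 4 * (p %/ 4) + 3 by rewrite {1}(divn_eq p 4) p3 mulnC.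
  have x_eq : (x = - x)%R.
    rewrite -[LHS]xp (congr1 (GRing.exp x) pE) exprD exprM.
    by rewrite (exprM x 2 2) (exprS x 2) x2 sqrrN !expr1n mul1r mulrN1.
  have : (x * 2%:R = 0)%R by rewrite mulr_natr mulr2n {1}x_eq addNr.
  move/eqP; rewrite mulf_eq0 -(dvdn_pcharf pch) gtnNdvd // orbF => /eqP x0.
  by move/eqP: x2; rewrite x0 expr0n eq_sym oppr_eq0 oner_eq0.
by rewrite (dvd_snd a b) // (dvd_snd b a) // addnC.
Qed.

(** Descent: when [p] divides the sum it divides [a] and [b], and dividing both
    by [p] lowers the exponent by 2. *)
Lemma sum_squares_valuation p alpha u a b : prime p -> p = 3 %[mod 4] ->
  p ^ (2 * alpha + 1) * u = a ^ 2 + b ^ 2 -> p %| u.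
Proof.
move=> pp p3; elim: alpha a b => [|alpha IH] a b E.
  have /andP[] : (p %| a) && (p %| b).
    by apply: dvdn_sum_squares => //; rewrite -E dvdn_mulr.
  move=> /dvdnP[a' Ea] /dvdnP[b' Eb]; rewrite {a}Ea {b}Eb in E.
  have p0 := prime_gt0 pp.
  move: E; rewrite muln0 add0n expn1 !expnMn -mulnDl -mulnn mulnA [LHS]mulnC => /eqP.
  by rewrite eqn_pmul2r // => /eqP ->; rewrite dvdn_mull.
have /andP[] : (p %| a) && (p %| b).
  by apply: dvdn_sum_squares => //; rewrite -E addn1 expnS -mulnA dvdn_mulr.
move=> /dvdnP[a' Ea] /dvdnP[b' Eb]; apply: (IH a' b').
have p0 := prime_gt0 pp.
apply/eqP; rewrite -(eqn_pmul2r (m := p ^ 2)) ?expn_gt0 ?p0 // mulnDl -!expnMn.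
by rewrite -Ea -Eb -E mulnS -addnA (expnD p 2) -[X in _ == X]mulnA mulnC.
Qed.

(** * The congruence *)

Lemma pp_mul3_dvd n : (forall a b, n <> a ^ 2 + b ^ 2) -> 3 %| pp (3 * n).
Proof.
move=> nsq; rewrite (dvdn_pcharf (pchar_Fp (isT : prime 3))) (pp_mul3 (ltnSn _)).
apply/eqP; rewrite expr2 coefM; apply: big1 => /= i _; apply/eqP.
rewrite mulf_eq0; apply/contraT; rewrite negb_or.
case/andP=> /theta_coef_square[a Ea] /theta_coef_square[b Eb].
by case: (nsq a b); rewrite -Ea -Eb subnKC // -ltnS ltn_ord.
Qed.

Theorem theorem4p2 :
  (forall p s : nat, prime p -> p = 3 %[mod 4] -> 1 <= s < p ->
   forall alpha n : nat,
     pp (3 * p ^ (2 * alpha + 1) * (p * n + s)) = 0 %[mod 3])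
  /\
  (forall alpha n : nat, 1 <= alpha ->
     pp (9 ^ alpha * (3 * n + 1)) = 0 %[mod 3] /\
     pp (9 ^ alpha * (3 * n + 2)) = 0 %[mod 3]).
Proof.
have main p s : prime p -> p = 3 %[mod 4] -> 1 <= s < p ->
   forall alpha n : nat,
     pp (3 * p ^ (2 * alpha + 1) * (p * n + s)) = 0 %[mod 3].
  move=> pp p3 /andP[s_gt0 lt_sp] alpha n; apply/eqP; rewrite mod0n -mulnA.
  apply: pp_mul3_dvd => a b /(sum_squares_valuation pp p3).
  by rewrite dvdn_addr ?dvdn_mulr // gtnNdvd.
(* For p = 3, one of the 2 * alpha factors 3 plays the role of the leading 3, and
   an odd power of p is left. *)
split=> // -[//|alpha] n _.
have -> : 9 ^ alpha.+1 = 3 * 3 ^ (2 * alpha + 1).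
  by rewrite -[9]/(3 ^ 2) -expnM -expnS mulnS addn1.
by split; apply: main.
Qed.
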